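(* Let $\mathcal{X}$ be a compact Hausdorff space and let $C(\mathcal{X})$ be the space of real-valued continuous functions on $\mathcal{X}$ with norm $\|g\|=\max\{|g(x)|:x\in\mathcal{X}\}$. Let $T\ge 1$, let $\mathcal{V}_0,\ldots,\mathcal{V}_T$ be finite-dimensional linear subspaces of $C(\mathcal{X})$ with bases $(v_{t,1},\ldots,v_{t,n_t})$ of $\mathcal{V}_t$, let $\varepsilon_0,\ldots,\varepsilon_T>0$, and let $$\mathcal{K}_t=\{g\in C(\mathcal{X}) : {\rm dist}(g,\mathcal{V}_t)\le\varepsilon_t\},\qquad t=0,1,\ldots,T.$$ Let the observation functionals $\lambda_{t,i}$, $t=0,\ldots,T$, $i=1,\ldots,m_t$, be the evaluations $\lambda_{t,i}(g)=g(x^{(t,i)})$ at points $x^{(t,i)}\in\mathcal{X}$ that are all distinct, and assume that the only $v \in \mathcal{V}_0$ with $v(x^{(0,i)})=0$ for all $i=1,\ldots,m_0$ is $v=0$. Set $m=m_0+\cdots+m_T$. Then a globally optimal recovery map for the evaluation $Q(f_0)=f_0(x)$ of $f_0$ at a new point $x\in\mathcal{X}$, i.e. $x\notin\{x^{(t,i)}: t=0,\ldots,T,\ i=1,\ldots,m_t\}$, is given by $$\Delta^{\rm opt}: y=[y_0;y_1;\ldots;y_T]\in\mathbb{R}^m\mapsto \sum_{i=1}^{m_0} a^{\rm opt}_{0,i}\,y_{0,i}+\sum_{t=1}^T\sum_{i=1}^{m_t} a^{\rm opt}_{t,i}\,y_{t,i}\in\mathbb{R},$$ where $a^{\rm opt}=[a_0^{\rm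 opt};a_1^{\rm opt};\ldots;a_T^{\rm opt}]\in\mathbb{R}^m$ is a solution to $$\underset{[a_0;a_1;\ldots;a_T]\in\mathbb{R}^m}{\rm minimize}\ \sum_{t=0}^T(\varepsilon_0+\cdots+\varepsilon_t)\|a_t\|_1 \quad\text{subject to } M^{(0)}[a_0;\ldots;a_T]=b,\quad M^{(s)}[a_s;\ldots;a_T]=0,\ s=1,\ldots,T.$$ Here $b\in\mathbb{R}^{n_0}$ and $M^{(s)}\in\mathbb{R}^{n_s\times(m_s+\cdots+m_T)}$, $s=0,1,\ldots,T$, have entries $$b_j=v_{0,j}(x),\qquad M^{(s)}_{j,(t,i)}=v_{s,j}(x^{(t,i)}),\quad t=s,\ldots,T,\ i=1,\ldots,m_t.$$
   Context: Write $\Lambda_t g=[g(x^{(t,1)});\ldots;g(x^{(t,m_t)})]\in\mathbb{R}^{m_t}$. An unknown $f_0\in C(\mathcal{X})$ comes with related $f_1,\ldots,f_T\in C(\mathcal{X})$, subject to $f_0\in\mathcal{K}_0$ and $f_{t-1}-f_t\in\mathcal{K}_t$ for $t=1,\ldots,T$, and observed through $y_t=\Lambda_t f_t$, $t=0,\ldots,T$. A recovery map is an arbitrary (not necessarily linear) map $\Delta:\mathbb{R}^m\to\mathbb{R}$. Its global worst-case error for the quantity of interest $Q$ is $${\rm gwce}(\Delta)=\sup\Big\{\big|Q(f_0)-\Delta([\Lambda_0f_0;\Lambda_1f_1;\ldots;\Lambda_Tf_T])\big| : f_0\in\mathcal{K}_0,\ f_{t-1}-f_t\in\mathcal{K}_t\text{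 for }t=1,\ldots,T\Big\}.$$ A recovery map is globally optimal if it minimizes ${\rm gwce}(\Delta)$ over all maps $\Delta:\mathbb{R}^m\to\mathbb{R}$. The notation $[a_s;\ldots;a_T]$ denotes vertical concatenation, and $\|\cdot\|_1$ is the $\ell_1$-norm. *)

(* Defs.v *)
From HB Require Import structures.
From mathcomp Require Import all_boot all_order all_algebra.
From mathcomp Require Import all_classical all_reals all_analysis.
Set Implicit Arguments.
Unset Strict Implicit.
Unset Printing Implicit Defensive.
Import Order.TTheory GRing.Theory Num.Theory.
Import numFieldNormedType.Exports.
Local Open Scope classical_set_scope.
Local Open Scope ring_scope.

(* C(X) as a set of functions: the library puts no vector space structure on
   its type of bundled continuous functions, while X -> R is an lmodType. *)
Definition CX (R : realType) (X : topologicalType) : set (X -> R) :=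
  [set g | continuous g].

(* On a nonempty compact space and for continuous g this sup is attained. *)
Definition maxnorm (R : realType) (X : topologicalType) (g : X -> R) : R :=
  sup [set `|g x| | x in [set: X]].

(* Used only for nonempty V (linear subspaces), where the inf is a true one. *)
Definition dist (R : realType) (X : topologicalType)
    (g : X -> R) (V : set (X -> R)) : R :=
  inf [set maxnorm (g - v) | v in V].

Definition approx_set (R : realType) (X : topologicalType)
    (V : set (X -> R)) (e : R) : set (X -> R) :=
  [set g | CX g /\ dist g V <= e].

(* The spanning equation also makes V a linear subspace; n = 0 is V = {0}. *)
Definition is_basis (R : realType) (X : Type) (n : nat)
    (v : 'I_n -> X -> R) (V : set (X -> R)) : Prop :=
  V = [set \sum_(j < n) c j *: v j | c in [set: 'I_n -> R]] /\
  forall c : 'I_n -> R, \sum_(j < n) c j *: v j = 0 -> forall j, c j = 0.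

Section Recovery.
Variables (R : realType) (X : topologicalType) (T : nat).
Variable m : 'I_T.+1 -> nat.
Variable pts : forall t : 'I_T.+1, 'I_(m t) -> X.

(* R^m, m = m_0 + ... + m_T; the block a_t of a vector a is [submxcol a t]. *)
Definition datavec := 'cV[R]_(\sum_(t < T.+1) m t).

Definition Lambda (t : 'I_T.+1) (g : X -> R) : 'cV[R]_(m t) :=
  \col_(i < m t) g (pts i).

Definition observe (f : 'I_T.+1 -> X -> R) : datavec :=
  \mxcol_(t < T.+1) Lambda t (f t).

(* The pair (widen_ord t, lift ord0 t), t = 0..T-1, is (t-1, t), t = 1..T. *)
Definition model (K : 'I_T.+1 -> set (X -> R)) : set ('I_T.+1 -> X -> R) :=
  [set f | [/\ forall t, CX (f t), K ord0 (f ord0) &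
     forall t : 'I_T,
       K (lift ord0 t) (f (widen_ord (leqnSn T) t) - f (lift ord0 t))]].

Definition gwce (K : 'I_T.+1 -> set (X -> R)) (Q : (X -> R) -> R)
    (Delta : datavec -> R) : \bar R :=
  ereal_sup [set `|Q (f ord0) - Delta (observe f)|%:E | f in model K].

Definition globally_optimal (K : 'I_T.+1 -> set (X -> R))
    (Q : (X -> R) -> R) (Delta : datavec -> R) : Prop :=
  forall Delta' : datavec -> R, (gwce K Q Delta <= gwce K Q Delta')%E.

(* The k-th index of the range s, s+1, ..., T; its value is s + k. *)
Definition tail_idx (s : 'I_T.+1) (k : 'I_(T.+1 - s)) : 'I_T.+1 :=
  cast_ord (subnKC (ltnW (ltn_ord s))) (rshift s k).

(* [a_s; ...; a_T] *)
Definition tail (s : 'I_T.+1) (a : datavec) :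
    'cV[R]_(\sum_(k < T.+1 - s) m (tail_idx k)) :=
  \mxcol_(k < T.+1 - s) submxcol a (tail_idx k).

Variable n : 'I_T.+1 -> nat.
Variable v : forall t : 'I_T.+1, 'I_(n t) -> X -> R.

Definition Mmx (s : 'I_T.+1) :
    'M[R]_(n s, \sum_(k < T.+1 - s) m (tail_idx k)) :=
  \mxrow_(k < T.+1 - s)
    \matrix_(j < n s, i < m (tail_idx k)) v j (pts i).

Definition bvec (x : X) : 'cV[R]_(n ord0) := \col_(j < n ord0) v j x.

Definition l1norm (k : nat) (a : 'cV[R]_k) : R := \sum_(i < k) `|a i 0|.

Definition objective (eps : 'I_T.+1 -> R) (a : datavec) : R :=
  \sum_(t < T.+1) (\sum_(s < T.+1 | (s <= t)%N) eps s) * l1norm (submxcol a t).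

Definition feasible (x : X) (a : datavec) : Prop :=
  Mmx ord0 *m tail ord0 a = bvec x /\
  forall s : 'I_T.+1, (0 < s)%N -> Mmx s *m tail s a = 0.

Definition is_solution (eps : 'I_T.+1 -> R) (x : X) (a : datavec) : Prop :=
  feasible x a /\
  forall a' : datavec, feasible x a' -> objective eps a <= objective eps a'.

Definition linear_recovery (a y : datavec) : R :=
  \sum_(i < m ord0) submxcol a ord0 i 0 * submxcol y ord0 i 0 +
  \sum_(t < T.+1 | (0 < t)%N)
    \sum_(i < m t) submxcol a t i 0 * submxcol y t i 0.

End Recovery.

(* Main.v *)
Require Import Defs.
From HB Require Import structures.
From mathcomp Require Import all_boot all_order all_algebra.
From mathcomp Require Import all_classical all_reals all_analysis.
From mathcomp Require Import ring lra.
Set Implicit Arguments.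
Unset Strict Implicit.
Unset Printing Implicit Defensive.
Import Order.TTheory GRing.Theory Num.Theory.
Import numFieldNormedType.Exports.
Local Open Scope classical_set_scope.
Local Open Scope ring_scope.

(** Write d_0 = f_0 and d_t = f_t - f_(t-1).  In these variables the model set
is the product of the sets K_s, which are symmetric, and f_t = d_0 + ... + d_t.

For a linear map with coefficients a, the error f_0(x) - Delta(y) splits as a
sum over s of functionals L_s(d_s), each a combination of point evaluations,
and the equality constraints of the program say that L_s vanishes on V_s.
Then |L_s(d_s)| is at most eps_s times the l1-norm of the coefficients of L_s,
and regrouping these bounds gives a worst-case error of at most
eps_0 + objective(a) ([gwce_linear_le]).

Conversely, the dual of the program maximizes w_0(x) over w_s in V_s subject to
|w_0 + ... + w_t| <= eps_0 + ... + eps_t at the nodes of level t.  A feasible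
(w_s) is turned into a model-consistent f with zero data and
f_0(x) = eps_0 + w_0(x): put d_s = w_s + eps_s phi, where the continuous phi
bounded by 1 has phi(x) = 1 and takes at each node the value that cancels f_t
there.  Such a phi exists by the Tietze extension theorem because the nodes and
x are distinct.  Since f and -f have the same data, no recovery map can have a
worst-case error below eps_0 + w_0(x) ([gwce_ge]).

The two bounds meet by strong duality for weighted l1 minimization under linear
constraints ([wl1_min_dual]), which is a finite-dimensional Hahn-Banach
argument.  A minimizer exists by compactness once the constraints are solvable,
and they are because the nodes of level 0 determine the elements of V_0. *)

(** * Hahn-Banach for functionals dominated by a weighted l1-norm *)

Definition sublinear (R : realType) (E : lmodType R) (p : E -> R) : Prop :=
  (forall y z, p (y + z) <= p y + p z) /\
  (forall a z, 0 < a -> p (a *: z) = a * p z).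

Lemma sublinear_add (R : realType) (E : lmodType R) (p q : E -> R) :
  sublinear p -> sublinear q -> sublinear (fun z => p z + q z).
Proof.
move=> [pD pZ] [qD qZ]; split=> [y z|a z a0]; last by rewrite pZ// qZ// mulrDr.
by rewrite addrACA lerD.
Qed.

Lemma sublinear_scalar (R : realType) (E : lmodType R) (c : R)
    (xi : {scalar E}) : sublinear (fun z => c * xi z).
Proof.
by split=> [y z|a z _]; [rewrite linearD mulrDr | rewrite linearZ/= mulrCA].
Qed.

Lemma sublinear_abs (R : realType) (E : lmodType R) (c : R)
    (xi : {scalar E}) : 0 <= c -> sublinear (fun z => c * `|xi z|).
Proof.
move=> c0; split=> [y z|a z a0].
  by rewrite linearD -mulrDr ler_wpM2l// ler_normD.
by rewrite linearZ/= normrM gtr0_norm// mulrCA.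
Qed.

(** One step of the Hahn-Banach argument.  By homogeneity only the vectors with
xi = 1 and xi = -1 constrain r: the former bound it below by - p, the latter
above by p, and these bounds are compatible because the sum of two such vectors
lies in the kernel of xi, where p is nonnegative. *)
Lemma linearize_abs (R : realType) (E : lmodType R) (p : E -> R)
    (xi : {scalar E}) (c : R) : 0 <= c -> sublinear p ->
  (forall z, 0 <= p z + c * `|xi z|) ->
  exists2 r, `|r| <= c & forall z, 0 <= p z + r * xi z.
Proof.
move=> c0 [pD pZ] p_ge.
(* The element - c both makes S nonempty and enforces - c <= sup S. *)
pose S : set R := [set s | s = - c \/ exists2 z, xi z = 1 & s = - p z].
have S0 : S !=set0 by exists (- c); left.
have S_le_c : ubound S c.
  move=> _ [->|[z xiz ->]]; first lra.
  by have := p_ge z; rewrite xiz normr1 mulr1; lra.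
have S_le y : xi y = - 1 -> ubound S (p y).
  move=> xiy _ [->|[z xiz ->]].
    by have := p_ge y; rewrite xiy normrN1 mulr1; lra.
  have := p_ge (z + y); rewrite linearD xiz xiy addrN normr0 mulr0 addr0.
  by have := pD z y; lra.
have hS : has_sup S by split=> //; exists c.
have le_r s : S s -> s <= sup S by move=> Ss; exact: sup_upper_bound.
exists (sup S).
  by rewrite ler_norml le_r/= ?ge_sup//; left.
have rescale z : xi z != 0 ->
    0 <= p (`|xi z|^-1 *: z) + sup S * (xi z / `|xi z|) ->
    0 <= p z + sup S * xi z.
  move=> t0; have nt : 0 < `|xi z| by rewrite normr_gt0.
  rewrite pZ ?invr_gt0// => h.
  have := mulr_ge0 (ltW nt) h; rewrite mulrDr mulrA divff ?gt_eqF// mul1r.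
  by rewrite (_ : `|xi z| * _ = sup S * xi z)//; field; rewrite normr_eq0.
move=> z; have [xi0|xi_pos|xi_neg] := ltgtP (xi z) 0.
- apply: rescale; first by rewrite lt_eqF.
  rewrite ltr0_norm// invrN mulrN divff ?lt_eqF// mulrN1.
  suff : sup S <= p (- (xi z)^-1 *: z) by lra.
  apply: ge_sup => //; apply: S_le.
  by rewrite linearZ/= mulNr mulVf// lt_eqF.
- apply: rescale; first by rewrite gt_eqF.
  rewrite gtr0_norm// divff ?gt_eqF// mulr1.
  suff : - p ((xi z)^-1 *: z) <= sup S by lra.
  apply: le_r; right; exists ((xi z)^-1 *: z) => //.
  by rewrite linearZ/= mulVf// gt_eqF.
- by have := p_ge z; rewrite xi_neg normr0 !mulr0.
Qed.

(** The absolute values are replaced one at a time; those not yet treated are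
sublinear and are carried along inside p. *)
Lemma linearize_sum_abs (R : realType) (E : lmodType R) (N : nat)
    (p : E -> R) (xi : 'I_N -> {scalar E}) (c : 'I_N -> R) :
  (forall i, 0 <= c i) -> sublinear p ->
  (forall z, 0 <= p z + \sum_(i < N) c i * `|xi i z|) ->
  exists2 r : 'I_N -> R, forall i, `|r i| <= c i &
    forall z, 0 <= p z + \sum_(i < N) r i * xi i z.
Proof.
elim: N p xi c => [|N IH] p xi c c0 subp p_ge.
  by exists (fun=> 0) => [[]//|z]; have := p_ge z; rewrite !big_ord0.
have [||z|r r_le r_ge] := IH (fun z => p z + c ord0 * `|xi ord0 z|)
    (fun i => xi (lift ord0 i)) (fun i => c (lift ord0 i)).
- by move=> i; exact: c0.
- exact/sublinear_add/sublinear_abs.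
- by have := p_ge z; rewrite big_ord_recl addrA.
have sub_rest : sublinear (fun z => \sum_(i < N) r i * xi (lift ord0 i) z).
  split=> [y z|a z _].
    by rewrite -big_split/=; apply: ler_sum => i _; rewrite linearD mulrDr.
  by rewrite mulr_sumr; apply: eq_bigr => i _; rewrite linearZ/= mulrCA.
have [||z|r0 r0_le r0_ge] := @linearize_abs R E
    (fun z => p z + \sum_(i < N) r i * xi (lift ord0 i) z) (xi ord0) (c ord0).
- exact: c0.
- exact: sublinear_add.
- by have := r_ge z; rewrite addrAC.
exists (fun i => if unlift ord0 i is Some j then r j else r0) => [i|z].
  by case: unliftP => [j ->|->].
rewrite big_ord_recl unlift_none; under eq_bigr do rewrite liftK.
by have := r0_ge z; rewrite -addrA [_ + r0 * _]addrC.
Qed.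

(** A linear functional dominated by a weighted l1-norm of coordinates is a
combination of them with coefficients within the weights: the nonnegative
functional - L + sum r_i xi_i is linear, hence zero. *)
Lemma l1_dominated_functional (R : realType) (E : lmodType R) (N : nat)
    (L : {scalar E}) (xi : 'I_N -> {scalar E}) (c : 'I_N -> R) :
  (forall i, 0 <= c i) -> (forall z, L z <= \sum_(i < N) c i * `|xi i z|) ->
  exists2 r : 'I_N -> R, forall i, `|r i| <= c i &
    forall z, L z = \sum_(i < N) r i * xi i z.
Proof.
move=> c0 L_le.
have [|z|r r_le r_ge] := @linearize_sum_abs R E N (fun z => - 1 * L z) xi c c0.
- exact: sublinear_scalar.
- by have := L_le z; lra.
exists r => // z; have := r_ge z; have := r_ge (- z).
under eq_bigr do rewrite linearN mulrN.
by rewrite sumrN linearN/=; lra.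
Qed.

(** * Weighted l1 minimization under linear constraints *)

Lemma row_space_dual (F : fieldType) (m1 m2 N : nat)
    (r : 'M[F]_(m1, N)) (A : 'M[F]_(m2, N)) :
  (forall k : 'cV_N, A *m k = 0 -> r *m k = 0) -> (r <= A)%MS.
Proof.
move=> rA; rewrite submxE; apply/eqP/matrixP => i j.
have := rA (col j (cokermx A)); rewrite !colE (mulmxA A) (mulmxA r).
rewrite mulmx_coker mul0mx.
by rewrite -colE => /(_ erefl)/matrixP/(_ i 0); rewrite !mxE.
Qed.

(** Fredholm alternative: stated through left multipliers, it allows checking
solvability on functionals instead of exhibiting a solution. *)
Lemma solvable_dual (F : fieldType) (m1 N : nat)
    (A : 'M[F]_(m1, N)) (b : 'cV_m1) :
  (forall mu : 'rV_m1, mu *m A = 0 -> mu *m b = 0) -> exists a, A *m a = b.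
Proof.
move=> Ab; have /submxP[D bD] : (b^T <= A^T)%MS.
  apply: row_space_dual => k /(congr1 trmx).
  rewrite trmx_mul trmxK trmx0 => /Ab.
  by move=> /(congr1 trmx); rewrite trmx_mul trmxK trmx0.
by exists D^T; rewrite -[b]trmxK bD trmx_mul trmxK.
Qed.

Definition wl1norm (R : realType) (N : nat)
    (c : 'I_N -> R) (a : 'cV[R]_N) : R :=
  \sum_(i < N) c i * `|a i 0|.

(** Strong duality, with attained dual.  On the span of the minimizer a and of
the kernel of A, consider the functional that is the optimal value at a and 0
on the kernel.  Optimality of a says that the weighted l1-norm dominates it, so
it is given by a vector r bounded by the weights; r kills the kernel of A, hence
r = mu A. *)
Lemma wl1_min_dual (R : realType) (P N : nat) (A : 'M[R]_(P, N)) (b : 'cV_P)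
    (c : 'I_N -> R) (a : 'cV_N) : (forall i, 0 <= c i) -> A *m a = b ->
  (forall a', A *m a' = b -> wl1norm c a <= wl1norm c a') ->
  exists2 mu : 'rV_P, forall i, `|(mu *m A) 0 i| <= c i &
    (mu *m b) 0 0 = wl1norm c a.
Proof.
move=> c0 Aab a_min.
(* B z runs over that span, with the coefficient of a as first entry of z. *)
pose B : 'M[R]_(N, 1 + N) := row_mx a (cokermx A).
have lin_entry M k (i : 'I_M) (D : 'M[R]_(M, k)) :
    scalar (fun z : 'cV[R]_k => (D *m z) i 0).
  by move=> t y z; rewrite mulmxDr -scalemxAr !mxE.
pose xi (i : 'I_N) : {scalar 'cV[R]_(1 + N)} := HB.pack
  (fun z : 'cV[R]_(1 + N) => (B *m z) i 0)
  (GRing.isLinear.Build _ _ _ _ _ (lin_entry _ _ i B)).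
pose L : {scalar 'cV[R]_(1 + N)} := HB.pack
  (fun z : 'cV[R]_(1 + N) =>
     ((wl1norm c a *: row_mx 1%:M 0 : 'M[R]_(1, 1 + N)) *m z) 0 0)
  (GRing.isLinear.Build _ _ _ _ _ (lin_entry _ _ 0 _)).
have zE (z : 'cV[R]_(1 + N)) : z = col_mx (z ord0 0)%:M (dsubmx z).
  rewrite -{1}[z]vsubmxK; congr (col_mx _ _).
  rewrite [usubmx z]mx11_scalar !mxE.
  by congr ((z _ _)%:M); apply: val_inj.
have LE (z : 'cV[R]_(1 + N)) : L z = z ord0 0 * wl1norm c a.
  rewrite /L/= -scalemxAl mxE mulrC; congr (_ * _).
  rewrite -[z]vsubmxK mul_row_col mul1mx mul0mx addr0.
  by rewrite [in RHS]mxE; case: splitP => // j _; rewrite ord1.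
have [z|r r_le rL] := @l1_dominated_functional R _ N L xi c c0.
  rewrite LE -[leRHS]/(wl1norm c (B *m z)).
  have B0 : 0 <= wl1norm c (B *m z) by apply: sumr_ge0 => i _; rewrite mulr_ge0.
  have [z0|z0] := lerP (z ord0 0) 0.
    by apply: le_trans B0; apply: mulr_le0_ge0 => //; apply: sumr_ge0 => i _;
      rewrite mulr_ge0.
  (* Divided by the first entry of z, B z is again a solution. *)
  have AB : A *m (B *m z) = z ord0 0 *: b.
    rewrite mulmxA mul_mx_row Aab mulmx_coker {1}[z]zE mul_row_col mul0mx addr0.
    by rewrite mul_mx_scalar.
  have := a_min ((z ord0 0)^-1 *: (B *m z)).
  rewrite -scalemxAr AB scalerA mulVf ?gt_eqF// scale1r => /(_ erefl).
  rewrite [leRHS](_ : _ = (z ord0 0)^-1 * wl1norm c (B *m z)); last first.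
    rewrite mulr_sumr; apply: eq_bigr => i _.
    by rewrite mxE normrM gtr0_norm ?invr_gt0// mulrCA.
  by rewrite [_^-1 * _]mulrC ler_pdivlMr// [_ * z _ _]mulrC.
pose rv := \row_i r i.
have rvB (z : 'cV[R]_(1 + N)) : (rv *m (B *m z)) 0 0 = z ord0 0 * wl1norm c a.
  by rewrite -LE rL mxE; apply: eq_bigr => i _; rewrite mxE.
have /submxP[mu rvE] : (rv <= A)%MS.
  rewrite submxE; apply/eqP/matrixP => i j; rewrite ord1.
  have := rvB (col_mx 0 (delta_mx j 0)).
  rewrite mul_row_col mulmx0 add0r (mulmxA rv) -colE mxE => ->.
  by rewrite mxE; case: splitP => // k _; rewrite !mxE mul0r.
exists mu => [i|]; first by rewrite -rvE mxE.
have := rvB (col_mx 1%:M 0).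
rewrite mul_row_col mulmx1 mulmx0 addr0 rvE -mulmxA Aab => ->.
by rewrite mxE; case: splitP => // k _; rewrite ord1 !mxE mul1r.
Qed.

Lemma continuous_sum (R : realType) (U : topologicalType) (I : Type)
    (s : seq I) (F : I -> U -> R) :
  (forall i, continuous (F i)) -> continuous (fun y => \sum_(i <- s) F i y).
Proof.
move=> cF; elim: s => [|i s IH].
  by under eq_fun do rewrite big_nil; exact: cst_continuous.
under eq_fun do rewrite big_cons.
by move=> y; apply: cvgD; [exact: cF|exact: IH].
Qed.

(** Positive weights make the sublevel sets of the objective bounded, so that
it suffices to minimize over the compact set of solutions that do at least as
well as a0. *)
Lemma wl1_min_exists (R : realType) (P N : nat) (A : 'M[R]_(P, N)) (b : 'cV_P)
    (c : 'I_N -> R) (a0 : 'cV_N) : (forall i, 0 < c i) -> A *m a0 = b ->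
  exists2 a, A *m a = b &
    forall a', A *m a' = b -> wl1norm c a <= wl1norm c a'.
Proof.
move=> c_gt0 Aa0.
pose M := wl1norm c a0.
pose norm_row (u : 'rV[R]_N) := wl1norm c u^T.
have entry_cont i : continuous (fun u : 'rV[R]_N => u^T i 0).
  by under eq_fun do rewrite mxE; exact: coord_continuous.
have norm_cont : continuous norm_row.
  apply: continuous_sum => i y.
  apply: (@continuousM _ _ (fun=> c i) (fun u : 'rV[R]_N => `|u^T i 0|)).
    exact: cst_continuous.
  apply: continuous_comp; last exact: norm_continuous.
  exact: entry_cont.
pose S : set 'rV[R]_N := [set u | A *m u^T = b /\ norm_row u <= M].
have [|||u /[!inE] -[Au uM] u_min] := @EVT_min_rV R N norm_row S.
- by exists a0^T; rewrite /S/= /norm_row trmxK.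
- apply: bounded_closed_compact.
    exists (\sum_(i < N) M / c i); split; first exact: num_real.
    move=> B ltB u [_ uM].
    have uij (i : 'I_N) : `|u ord0 i| <= M / c i.
      rewrite ler_pdivlMr// mulrC; apply: le_trans uM.
      rewrite /norm_row /wl1norm (bigD1 i)//= mxE lerDl.
      by apply: sumr_ge0 => j _; rewrite mulr_ge0// ltW.
    have M0 (i : 'I_N) : 0 <= M / c i by apply: le_trans (uij i).
    rewrite /= [leLHS]/Num.Def.normr/= mx_normrE; apply/bigmax_leP; split.
      by apply: le_trans (ltW ltB); apply: sumr_ge0.
    case=> k i _ /=; rewrite ord1; apply: le_trans (ltW ltB).
    by rewrite (bigD1 i)//= (le_trans (uij i))// lerDl sumr_ge0.
  have -> : S = [set u | norm_row u <= M] `&`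
     \bigcap_(p in [set: 'I_P]) [set u | (A *m u^T) p 0 = b p 0].
    apply/seteqP; split=> u.
      by move=> [Au uM]; split=> // p _ /=; rewrite Au.
    move=> [uM Au]; split=> //.
    by apply/matrixP => p k; rewrite ord1; exact: Au.
  apply: closedI.
    exact: (preimage_closed (in1W norm_cont) (@closed_le R M)).
  apply: closed_bigI => p _.
  apply: (@preimage_closed _ _ (fun u : 'rV[R]_N => (A *m u^T) p 0)
    [set b p 0]).
    apply: in1W; under eq_fun do rewrite mxE.
    apply: continuous_sum => i y.
    apply: (@continuousM _ _ (fun=> A p i) (fun u : 'rV[R]_N => u^T i 0)).
      exact: cst_continuous.
    exact: entry_cont.
  exact: closed_eq.
- exact: continuous_subspaceT.
exists u^T => // a' Aa'; have [le_M|/ltW lt_M] := lerP (wl1norm c a') M.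
  have := u_min a'^T; rewrite inE /norm_row trmxK; apply.
  by rewrite /S/= /norm_row trmxK.
exact: le_trans uM lt_M.
Qed.

(** * Approximation sets in the space of continuous functions *)

Lemma continuous_scale (R : realType) (U : topologicalType)
    (k : R) (f : U -> R) :
  continuous f -> continuous (k *: f : U -> R).
Proof.
by move=> fC y; apply: (@continuousM _ _ (fun=> k) f);
  [exact: cst_continuous|exact: fC].
Qed.

(** Tietze's theorem applies because every function is continuous on a finite
subset of a Hausdorff space, the induced topology being discrete. *)
Lemma finite_set_extension (R : realType) (X : topologicalType) (A : set X)
    (f : X -> R) (M : R) :
  compact [set: X] -> hausdorff_space X -> finite_set A -> 0 < M ->
  (forall y, A y -> `|f y| <= M) ->
  exists g : X -> R,
    [/\ continuous g, forall y, A y -> g y = f y & forall y, `|g y| <= M].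
Proof.
move=> cX hX finA M0 fM.
have /accessible_finite_set_closed closedF : accessible_space X.
  exact: hausdorff_accessible.
have cf : {within A, continuous (f : X -> R^o)}.
  apply/subspace_continuousP => y Ay.
  have isolated : within A (nbhs y) [set y].
    have : nbhs y (~` (A `\ y)).
      apply: open_nbhs_nbhs; split; last by case=> _; apply.
      by rewrite openC; apply: closedF; exact: finite_setD.
    apply: filterS => z nz Az.
    by apply: contrapT => /= zy; exact: nz.
  by move=> B /nbhs_singleton Bfy; apply: filterS isolated => z ->.
have [g [gf gc gM]] := continuous_bounded_extension
  (compact_normal hX cX) (closedF _ finA) M0 cf fM.
by exists g; split=> // y Ay; rewrite gf// inE.
Qed.

Lemma maxnorm_ge (R : realType) (X : topologicalType) (g : X -> R) (y : X) :
  compact [set: X] -> continuous g -> `|g y| <= maxnorm g.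
Proof.
move=> cX cg; apply: sup_upper_bound; last by exists y.
split; first by exists `|g y|, y.
have : compact (g @` [set: X]).
  by apply: continuous_compact => //; exact: continuous_subspaceT.
move=> /compact_bounded[M [_ gM]]; exists (M + 1) => _ [z _ <-].
by apply: (gM (M + 1)); [rewrite ltrDl|exists z].
Qed.

Lemma maxnorm_ge0 (R : realType) (X : topologicalType) (g : X -> R) :
  0 <= maxnorm g.
Proof.
have [hs|/sup_out] := pselect (has_sup [set `|g y| | y in [set: X]]);
  last first.
  by rewrite /maxnorm => ->.
case: (hs) => -[_ [y _ _]] _; apply: le_trans (normr_ge0 (g y)) _.
by apply: sup_upper_bound => //; exists y.
Qed.

Lemma approx_set_near (R : realType) (X : topologicalType) (V : set (X -> R))
    (g v : X -> R) (e : R) (y0 : X) : CX g -> V v ->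
  (forall y, `|g y - v y| <= e) -> approx_set V e g.
Proof.
move=> cg Vv gve; split=> //.
apply: (@le_trans _ _ (maxnorm (g - v))).
  by apply: ge_inf; [exists 0 => _ [w _ <-]; exact: maxnorm_ge0|exists v].
by apply: ge_sup; [exists `|(g - v) y0|, y0|move=> _ [y _ <-]; exact: gve].
Qed.

(** L g = L (g - v) for every v in V, and the distance is the infimum of the
norms of these differences.  As that infimum is only approached, a slack eta is
used, chosen so that C * eta is at most the allowed error d; the denominator is
C + 1 because C may be 0. *)
Lemma annihilator_bound (R : realType) (X : topologicalType) (V : set (X -> R))
    (e C : R) (L : (X -> R) -> R) (g : X -> R) :
  compact [set: X] -> V !=set0 -> V `<=` @CX R X ->
  (forall g h, L (g - h) = L g - L h) -> (forall v, V v -> L v = 0) ->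
  (forall M g, (forall y, `|g y| <= M) -> `|L g| <= C * M) ->
  approx_set V e g -> `|L g| <= C * e.
Proof.
move=> cX V0 Vc LB LV LC [cg ge].
have C0 : 0 <= C.
  have := LC 1 0 _; rewrite mulr1 => LC1; apply: le_trans (normr_ge0 _) (LC1 _).
  by move=> y; rewrite normr0.
apply/ler_addgt0Pr => d d0.
pose eta := d / (C + 1).
have C1 : 0 < C + 1 by rewrite ltr_wpDl.
have [||_ [v Vv <-] ve] := @inf_adherent R [set maxnorm (g - v) | v in V] eta.
- exact: divr_gt0.
- split; first by case: V0 => v Vv; exists (maxnorm (g - v)), v.
  by exists 0 => _ [w _ <-]; exact: maxnorm_ge0.
have -> : L g = L (g - v) by rewrite LB (LV v)// subr0.
apply: le_trans (LC (maxnorm (g - v)) _ _) _.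
  move=> y; apply: (@maxnorm_ge _ _ (g - v)) => // z.
  by apply: cvgB; [exact: cg|exact: Vc].
apply: (@le_trans _ _ (C * (e + eta))).
  by rewrite ler_wpM2l// (le_trans (ltW ve))// lerD2r.
rewrite mulrDr lerD2l /eta mulrA ler_pdivrMr// mulrC ler_wpM2l ?ltW//.
by rewrite ltrDl.
Qed.

(** * Families of functions and their increments *)

Definition cumul (U : nmodType) (T : nat)
    (d : 'I_T.+1 -> U) (t : 'I_T.+1) : U :=
  \sum_(s < T.+1 | (s <= t)%N) d s.

Lemma cumul_ord0 (U : nmodType) (T : nat) (d : 'I_T.+1 -> U) :
  cumul d ord0 = d ord0.
Proof.
by rewrite /cumul (bigD1 ord0)//= big1 ?addr0// => s; rewrite leqn0 andbN.
Qed.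

Lemma cumul_lift (U : nmodType) (T : nat) (d : 'I_T.+1 -> U) (t : 'I_T) :
  cumul d (lift ord0 t) = d (lift ord0 t) + cumul d (widen_ord (leqnSn T) t).
Proof.
rewrite /cumul (bigD1 (lift ord0 t))//=; congr (_ + _); apply: eq_bigl => s.
by rewrite -val_eqE/= /bump/= add1n andbC -ltn_neqAle ltnS.
Qed.

Definition increments (U : zmodType) (T : nat)
    (f : 'I_T.+1 -> U) (s : 'I_T.+1) : U :=
  if unlift ord0 s is Some t
  then f (lift ord0 t) - f (widen_ord (leqnSn T) t) else f ord0.

Lemma cumul_increments (U : zmodType) (T : nat)
    (f : 'I_T.+1 -> U) (t : 'I_T.+1) :
  cumul (increments f) t = f t.
Proof.
have [k] := ubnP t; elim: k t => // k IH t.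
case: (unliftP ord0 t) => [s ->|->]; last first.
  by rewrite cumul_ord0 /increments unlift_none.
rewrite lift0 !ltnS => sk.
by rewrite cumul_lift IH// /increments liftK subrK.
Qed.

Lemma sum_tail_idx (U : nmodType) (T : nat) (s : 'I_T.+1) (F : 'I_T.+1 -> U) :
  \sum_(k < T.+1 - s) F (@tail_idx T s k) = \sum_(t < T.+1 | (s <= t)%N) F t.
Proof.
have e := subnKC (ltnW (ltn_ord s)).
rewrite (reindex (cast_ord e))/=; last first.
  by exists (cast_ord (esym e)) => k _; [exact: cast_ordK|exact: cast_ordKV].
rewrite big_split_ord/= [X in _ = X + _]big_pred0 ?add0r; last first.
  by move=> k; rewrite /= leqNgt ltn_ord.
apply: eq_big => [k|k _]; first by rewrite leq_addr.
by congr F; apply: val_inj.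
Qed.

(** * The linear program and the error of a linear recovery map *)

Section LinearProgram.
Variables (R : realType) (X : topologicalType) (T : nat).
Variables (m : 'I_T.+1 -> nat) (pts : forall t : 'I_T.+1, 'I_(m t) -> X).
Variables (n : 'I_T.+1 -> nat) (v : forall t : 'I_T.+1, 'I_(n t) -> X -> R).

Definition eval_mx (s t : 'I_T.+1) : 'M[R]_(n s, m t) :=
  \matrix_(j, i) @v s j (@pts t i).

(** All the constraints as a single system: a square array of blocks with the
levels s of the spaces as rows and the levels t of the nodes as columns. *)
Definition constraint_mx : 'M[R]_(\sum_s n s, \sum_t m t) :=
  \mxblock_(s, t) (if (s <= t)%N then eval_mx s t else 0).

Definition constraint_rhs (x : X) : 'cV[R]_(\sum_s n s) :=
  \mxcol_s (if s == ord0 then \col_j @v s j x else 0).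

Lemma Mmx_tail (s : 'I_T.+1) (a : datavec R m) :
  Mmx pts v s *m tail s a =
  \sum_(t < T.+1 | (s <= t)%N) eval_mx s t *m submxcol a t.
Proof.
rewrite /Mmx /tail mul_mxrow_mxcol.
exact: (sum_tail_idx _ (fun t => eval_mx s t *m submxcol a t)).
Qed.

Lemma constraint_mxE (a : datavec R m) : constraint_mx *m a =
  \mxcol_s \sum_(t < T.+1 | (s <= t)%N) eval_mx s t *m submxcol a t.
Proof.
rewrite -{1}[a]submxcolK mul_mxblock_mxrow; apply: eq_mxcol => s.
by rewrite [RHS]big_mkcond; apply: eq_bigr => t _; case: ifP; rewrite ?mul0mx.
Qed.

Lemma feasibleE (x : X) (a : datavec R m) :
  feasible pts v x a <-> constraint_mx *m a = constraint_rhs x.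
Proof.
rewrite constraint_mxE /constraint_rhs; split=> [[a0 aS]|/eq_mxcolP aE].
  apply: eq_mxcol => s; rewrite -Mmx_tail; case: eqVneq => [->//|s0].
  by apply: aS; rewrite lt0n.
split=> [|s s0]; first by rewrite Mmx_tail aE.
by rewrite Mmx_tail aE -val_eqE/= gtn_eqF.
Qed.

(** A multiplier of the constraints is a choice of one element in each V_s:
block s of mu lists its coordinates in the basis of V_s. *)
Definition component (mu : 'rV[R]_(\sum_s n s)) (s : 'I_T.+1) : X -> R :=
  \sum_(j < n s) submxrow mu s 0 j *: @v s j.

Lemma componentE mu s y :
  component mu s y = \sum_(j < n s) submxrow mu s 0 j * @v s j y.
Proof. by rewrite /component fct_sumE. Qed.

(** The dual constraints bound these values: a multiplier enters the dual
program only through the partial sums of its components at the nodes. *)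
Lemma mul_constraint_mx mu (t : 'I_T.+1) (i : 'I_(m t)) :
  (mu *m constraint_mx) 0 (tagnat.Rank t i) = cumul (component mu) t (@pts t i).
Proof.
transitivity (submxrow (mu *m constraint_mx) t 0 i); first by rewrite [RHS]mxE.
rewrite -{1}[mu]submxrowK mul_mxrow_mxblock mxrowK summxE /cumul fct_sumE.
rewrite [RHS]big_mkcond; apply: eq_bigr => s _; case: ifP => _.
  by rewrite componentE mxE; apply: eq_bigr => j _; rewrite !mxE.
by rewrite mulmx0 mxE.
Qed.

Lemma mul_constraint_rhs mu (x : X) :
  (mu *m constraint_rhs x) 0 0 = component mu ord0 x.
Proof.
rewrite -{1}[mu]submxrowK mul_mxrow_mxcol summxE (bigD1 ord0)//=.
rewrite big1 ?addr0 => [|s /negbTE ->]; last by rewrite mulmx0 mxE.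
by rewrite componentE mxE; apply: eq_bigr => j _; rewrite !mxE.
Qed.

Lemma objectiveE (eps : 'I_T.+1 -> R) (a : datavec R m) :
  objective eps a = wl1norm (fun k => cumul eps (tagnat.sig1 k)) a.
Proof.
rewrite /objective /wl1norm /l1norm.
transitivity (\sum_t \sum_(i < m t) cumul eps t * `|submxcol a t i 0|).
  by apply: eq_bigr => t _; rewrite mulr_sumr.
rewrite [LHS]sig_big_dep/= [LHS](reindex _ tagnat.sig_bij_on)/=.
by apply: eq_bigr => k _; rewrite mxE tagnat.sig2K.
Qed.

Lemma linear_recoveryE (a y : datavec R m) :
  linear_recovery a y =
  \sum_(t < T.+1) \sum_(i < m t) submxcol a t i 0 * submxcol y t i 0.
Proof.
rewrite [RHS](bigD1 ord0)//= /linear_recovery; congr (_ + _).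
by apply: eq_bigl => t; rewrite -val_eqE/= lt0n.
Qed.

(** The part of the recovery error that depends on the increment d_s: since d_s
occurs in f_t for all t >= s, it is seen by the nodes of all these levels. *)
Definition block_error (x : X) (a : datavec R m) (s : 'I_T.+1)
    (g : X -> R) : R :=
  (s == ord0)%:R * g x -
  \sum_(t < T.+1 | (s <= t)%N) \sum_(i < m t) submxcol a t i 0 * g (@pts t i).

Lemma block_error_scalar x a s : scalar (block_error x a s).
Proof.
move=> k g h; rewrite /block_error [k * _]mulrBr mulr_sumr.
rewrite addrACA -opprD -big_split/=; congr (_ - _).
  by rewrite mulrDr mulrCA.
apply: eq_bigr => t _; rewrite mulr_sumr -big_split/=.
by apply: eq_bigr => i _; rewrite mulrDr mulrCA.
Qed.

HB.instance Definition _ x a s := GRing.isLinear.Build R (X -> R) R _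
  (block_error x a s) (block_error_scalar x a s).

(** The constraints of level s are the vanishing of this functional on the basis
of V_s; they are what makes a recovery map have a finite worst-case error. *)
Lemma block_error_basis x a s (j : 'I_(n s)) :
  feasible pts v x a -> block_error x a s (@v s j) = 0.
Proof.
move=> /feasibleE; rewrite constraint_mxE /constraint_rhs => /eq_mxcolP.
move=> /(_ s)/matrixP/(_ j 0).
rewrite summxE /block_error => E; apply/eqP; rewrite subr_eq0; apply/eqP.
transitivity (\sum_(t < T.+1 | (s <= t)%N) (eval_mx s t *m submxcol a t) j 0).
  by rewrite E; case: eqVneq => _; rewrite !mxE ?mul1r ?mul0r.
by apply: eq_bigr => t _; rewrite mxE; apply: eq_bigr => i _; rewrite mxE mulrC.
Qed.

Lemma block_error_le x a s M (g : X -> R) : (forall y, `|g y| <= M) ->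
  `|block_error x a s g| <=
  ((s == ord0)%:R + \sum_(t < T.+1 | (s <= t)%N) l1norm (submxcol a t)) * M.
Proof.
move=> gM; apply: le_trans (ler_normB _ _) _; rewrite mulrDl lerD//.
  by rewrite normrM ger0_norm// ler_wpM2l.
rewrite mulr_suml; apply: le_trans (ler_norm_sum _ _ _) _.
apply: ler_sum => t _.
rewrite mulr_suml; apply: le_trans (ler_norm_sum _ _ _) _.
apply: ler_sum => i _.
by rewrite normrM ler_wpM2l.
Qed.

Lemma recovery_error (x : X) (a : datavec R m) (f : 'I_T.+1 -> X -> R) :
  f ord0 x - linear_recovery a (observe pts f) =
  \sum_s block_error x a s (increments f s).
Proof.
rewrite /block_error big_split/= sumrN; congr (_ - _).
  rewrite (bigD1 ord0)//= big1 ?addr0 ?mul1r => [|s /negbTE ->]; last first.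
    by rewrite mul0r.
  by rewrite /increments unlift_none.
rewrite linear_recoveryE (exchange_big_dep predT)//=.
apply: eq_bigr => t _; rewrite exchange_big/=; apply: eq_bigr => i _.
rewrite -mulr_sumr; congr (_ * _).
rewrite mxcolK mxE -{1}(cumul_increments f t).
by rewrite /cumul fct_sumE.
Qed.

(** Exchanging the sums over s and t explains the weights of the objective: the
coefficients of level t are charged once by each eps_s with s <= t. *)
Lemma block_weight_sum (eps : 'I_T.+1 -> R) (a : datavec R m) :
  \sum_s ((s == ord0)%:R +
    \sum_(t < T.+1 | (s <= t)%N) l1norm (submxcol a t)) * eps s =
  eps ord0 + objective eps a.
Proof.
under eq_bigr do rewrite mulrDl; rewrite big_split/=; congr (_ + _).
  rewrite (bigD1 ord0)//= big1 ?addr0 ?mul1r// => s /negbTE ->; exact: mul0r.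
under eq_bigr do rewrite mulr_suml.
rewrite (exchange_big_dep predT)//=; apply: eq_bigr => t _.
by rewrite mulr_suml; apply: eq_bigr => s _; rewrite mulrC.
Qed.

End LinearProgram.

(** * Upper and lower bounds for the worst-case error *)

Section Optimality.
Variables (R : realType) (X : topologicalType) (T : nat).
Variables (V : 'I_T.+1 -> set (X -> R)).
Variables (n : 'I_T.+1 -> nat) (v : forall t : 'I_T.+1, 'I_(n t) -> X -> R).
Variable eps : 'I_T.+1 -> R.
Variables (m : 'I_T.+1 -> nat) (pts : forall t : 'I_T.+1, 'I_(m t) -> X).
Variable x : X.
Hypothesis X_compact : compact [set: X].
Hypothesis V_sub_CX : forall t, V t `<=` @CX R X.
Hypothesis v_basis : forall t, is_basis (@v t) (V t).

Let K t := approx_set (V t) (eps t).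
Let Q (g : X -> R) : R := g x.

Lemma component_in (mu : 'rV[R]_(\sum_s n s)) s : V s (component v mu s).
Proof. by rewrite (v_basis s).1; exists (fun j => submxrow mu s 0 j). Qed.

Lemma scale_in k s g : V s g -> V s (k *: g).
Proof.
rewrite (v_basis s).1 => -[c _ <-]; exists (fun j => k * c j) => //.
by rewrite scaler_sumr; apply: eq_bigr => j _; rewrite scalerA.
Qed.

Lemma gwce_linear_le (a : datavec R m) : feasible pts v x a ->
  (gwce pts K Q (linear_recovery a) <= (eps ord0 + objective eps a)%:E)%E.
Proof.
move=> feas; apply: ge_ereal_sup => _ [f [fC f0 fS] <-]; rewrite lee_fin.
rewrite recovery_error -block_weight_sum.
apply: le_trans (ler_norm_sum _ _ _) _; apply: ler_sum => s _.
pose w : R :=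
  (s == ord0)%:R + \sum_(t < T.+1 | (s <= t)%N) l1norm (submxcol a t).
have bound g : K s g -> `|block_error pts x a s g| <= w * eps s.
  apply: annihilator_bound => //.
  - by exists (component v 0 s); exact: component_in.
  - by move=> h h'; rewrite linearB.
  - move=> h; rewrite (v_basis s).1 => -[c _ <-].
    rewrite linear_sum big1// => j _.
    by rewrite linearZ/= (block_error_basis _ feas) mulr0.
  - by move=> M h; exact: block_error_le.
(* The model constrains f_(t-1) - f_t, the opposite of the increment. *)
move: bound; rewrite /w /increments; case: unliftP => [t ->|->] bound.
  by rewrite -opprB linearN normrN; apply: bound.
exact: bound.
Qed.

Lemma model_cumul (d : 'I_T.+1 -> X -> R) :
  (forall s, K s (d s)) -> (forall s, K s (- d s)) -> model K (cumul d).
Proof.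
move=> Kd KNd; split=> [t||t].
- rewrite (_ : cumul d t =
    fun y => \sum_(s <- [seq s : 'I_T.+1 <- index_enum _ | (s <= t)%N]) d s y).
    by apply: continuous_sum => s; exact: (Kd s).1.
  by apply/funext => y; rewrite /cumul fct_sumE big_filter.
- by rewrite cumul_ord0.
- by rewrite cumul_lift opprD addrCA addrN addr0.
Qed.

Hypothesis X_hausdorff : hausdorff_space X.
Hypothesis eps_gt0 : forall t, 0 < eps t.
Hypothesis pts_distinct :
  injective (fun p : {t : 'I_T.+1 & 'I_(m t)} => @pts (tag p) (tagged p)).
Hypothesis x_new : forall (t : 'I_T.+1) (i : 'I_(m t)), x <> @pts t i.

Lemma cumul_eps_gt0 t : 0 < cumul eps t.
Proof.
rewrite /cumul (bigD1 t)//= ltr_wpDr//.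
by apply: sumr_ge0 => s _; rewrite ltW.
Qed.

(** The prescribed values are consistent because the nodes are distinct and x is
not one of them. *)
Lemma interpolant (r : forall t : 'I_T.+1, 'I_(m t) -> R) :
  (forall t i, `|@r t i| <= 1) ->
  exists phi : X -> R, [/\ continuous phi, phi x = 1,
    forall t i, phi (@pts t i) = @r t i & forall y, `|phi y| <= 1].
Proof.
move=> r_le1.
pose node (p : {t : 'I_T.+1 & 'I_(m t)}) := @pts (tag p) (tagged p).
(* The default value 1 is what f takes at x. *)
pose f y :=
  if [pick p | node p == y] is Some p then @r (tag p) (tagged p) else 1.
have f_le1 y : `|f y| <= 1.
  by rewrite /f; case: pickP => [p _|_]; rewrite ?r_le1// normr1.
have [||phi [phiC phiE phi1]] :=
  @finite_set_extension R X (x |` range node) f 1 X_compact X_hausdorff _ ltr01.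
- rewrite finite_setU; split; first exact: finite_set1.
  by apply: finite_image; exact: finite_finset.
- by move=> y _.
exists phi; split=> // [|t i].
  rewrite phiE; last by left.
  rewrite /f; case: pickP => // p /eqP xp.
  by case: (@x_new (tag p) (tagged p)).
rewrite phiE; last by right; exists (Tagged (fun t => 'I_(m t)) i).
rewrite /f; case: pickP => [p /eqP|/(_ (Tagged (fun t => 'I_(m t)) i))];
  last by rewrite eqxx.
by move=> /(@pts_distinct p (Tagged (fun t => 'I_(m t)) i)) ->.
Qed.

(** Every multiplier feasible for the dual yields model-consistent f and -f with
zero data, which no recovery map can tell apart.  Whatever value Delta takes at
0, it is off by at least f_0(x) for one of the two. *)
Lemma gwce_ge (mu : 'rV[R]_(\sum_s n s)) (Delta : datavec R m -> R) :
  (forall k, `|(mu *m constraint_mx pts v) 0 k| <= cumul eps (tagnat.sig1 k)) ->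
  ((eps ord0 + component v mu ord0 x)%:E <= gwce pts K Q Delta)%E.
Proof.
move=> mu_le.
pose u := cumul (component v mu).
have u_le t i : `|u t (@pts t i)| <= cumul eps t.
  by have := mu_le (tagnat.Rank t i); rewrite mul_constraint_mx tagnat.Rank1K.
(* f_t = u_t + (eps_0 + ... + eps_t) phi has to vanish at the nodes. *)
have [|phi [phiC phix phi_pts phi1]] :=
    @interpolant (fun t i => - u t (@pts t i) / cumul eps t).
  move=> t i; rewrite normrM normrN normfV (gtr0_norm (cumul_eps_gt0 t)).
  by rewrite ler_pdivrMr ?cumul_eps_gt0// mul1r.
(* The factor k treats f (k = 1) and -f (k = -1) at once. *)
pose d k s : X -> R := k *: (component v mu s + eps s *: phi).
have fE k t y : cumul (d k) t y = k * (u t y + cumul eps t * phi y).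
  rewrite /u /cumul !fct_sumE mulr_suml -big_split/= mulr_sumr.
  by apply: eq_bigr.
have Kd k s : `|k| <= 1 -> K s (d k s).
  move=> k1; apply: (@approx_set_near _ _ _ _ (k *: component v mu s) _ x).
  - apply: continuous_scale => y; apply: continuousD.
      exact: (V_sub_CX (component_in mu s)).
    exact: continuous_scale.
  - exact/scale_in/component_in.
  move=> y; rewrite /d scalerDr [X in `|X|](_ : _ = k * (eps s * phi y)).
    rewrite normrM -[leRHS]mul1r ler_pM// normrM gtr0_norm//.
    by rewrite -[leRHS]mulr1 ler_wpM2l// ltW.
  by rewrite [LHS]addrAC addrN add0r.
have modelf k : `|k| <= 1 -> model K (cumul (d k)).
  move=> k1; apply: model_cumul => s; first exact: Kd.
  by rewrite /d -scaleNr; apply: Kd; rewrite normrN.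
have obsf k : observe pts (cumul (d k)) = 0.
  rewrite /observe -[RHS]mxcol0; apply: eq_mxcol => t; apply/matrixP => i j.
  rewrite !mxE fE phi_pts mulrCA divff ?gt_eqF ?cumul_eps_gt0//.
  by rewrite mulr1 addrN mulr0.
have le_gwce k : `|k| <= 1 ->
    (`|k * (eps ord0 + component v mu ord0 x) - Delta 0|%:E
      <= gwce pts K Q Delta)%E.
  move=> k1; apply: ereal_sup_ubound; exists (cumul (d k)); first exact: modelf.
  by rewrite /Q obsf fE /u !cumul_ord0 phix mulr1 [eps _ + _]addrC.
have [D0|D0] := lerP (Delta 0) 0.
  apply: le_trans (le_gwce 1 _); last by rewrite normr1.
  by rewrite lee_fin mul1r (le_trans _ (ler_norm _))//; lra.
apply: le_trans (le_gwce (-1) _); last by rewrite normrN1.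
by rewrite lee_fin mulN1r -opprD normrN (le_trans _ (ler_norm _))//; lra.
Qed.

End Optimality.

Theorem corollary3 (R : realType) (X : topologicalType)
  (X_compact : compact [set: X]) (X_hausdorff : hausdorff_space X)
  (T : nat) (T_ge1 : (1 <= T)%N)
  (V : 'I_T.+1 -> set (X -> R)) (V_sub_CX : forall t, V t `<=` @CX R X)
  (n : 'I_T.+1 -> nat) (v : forall t : 'I_T.+1, 'I_(n t) -> X -> R)
  (v_basis : forall t, is_basis (@v t) (V t))
  (eps : 'I_T.+1 -> R) (eps_gt0 : forall t, 0 < eps t)
  (m : 'I_T.+1 -> nat) (pts : forall t : 'I_T.+1, 'I_(m t) -> X)
  (pts_distinct :
     injective (fun p : {t : 'I_T.+1 & 'I_(m t)} => @pts (tag p) (tagged p)))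
  (V0_determined : forall w : X -> R, V ord0 w ->
     (forall i : 'I_(m ord0), w (@pts ord0 i) = 0) -> w = 0)
  (x : X) (x_new : forall (t : 'I_T.+1) (i : 'I_(m t)), x <> @pts t i) :
  (exists a : datavec R m, is_solution pts v eps x a) /\
  forall a : datavec R m, is_solution pts v eps x a ->
    globally_optimal pts (fun t => approx_set (V t) (eps t))
      (fun g : X -> R => g x) (linear_recovery a).
Proof.
have wt_gt0 (k : 'I_(\sum_t m t)) : 0 < cumul eps (tagnat.sig1 k).
  exact: cumul_eps_gt0.
split=> [|a [feas a_min] Delta].
  (* A multiplier killing all columns has a component of level 0 that vanishes
     at the nodes of level 0, hence is zero. *)
  have [|a0 Aa0] := @solvable_dual R _ _ (constraint_mx pts v)
      (constraint_rhs v x).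
    move=> mu muA0; apply/matrixP => i j; rewrite !ord1 mul_constraint_rhs mxE.
    rewrite (V0_determined (component v mu ord0)) => [//||i'].
      exact: (component_in v_basis).
    by rewrite -[component v mu ord0]cumul_ord0 -mul_constraint_mx muA0 mxE.
  have [a Aa a_min] := wl1_min_exists wt_gt0 Aa0.
  exists a; split=> [|a' /feasibleE Aa']; first exact/feasibleE.
  by rewrite !objectiveE; exact: a_min.
have [|a' Aa'|mu mu_le muE] := @wl1_min_dual R _ _ (constraint_mx pts v)
    (constraint_rhs v x) (fun k => cumul eps (tagnat.sig1 k)) a
    (fun k => ltW (wt_gt0 k)).
- exact/feasibleE.
- by rewrite -!objectiveE; apply: a_min; apply/feasibleE.
have upper := gwce_linear_le eps X_compact V_sub_CX v_basis feas.
apply: (le_trans upper).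
rewrite objectiveE -muE mul_constraint_rhs.
exact: (gwce_ge X_compact V_sub_CX v_basis X_hausdorff).
Qed.
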